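(* Let $E_1|H_1,\ldots,E_n|H_n$ be $n$ conditional events, with $x_i=P(E_i|H_i)$, $i=1,\ldots,n$, and with $\mathbb{P}(\mathcal{D}_n)=\eta_n$, where $\mathcal{D}_n=\bigvee_{i=1}^n(E_i|H_i)$. Then $$\max\{x_1,\ldots,x_n\}\leq\eta_n\leq\min\{x_1+\cdots+x_n,1\}.$$
   Context: Events are two-valued propositions (identified with subsets of the sure event $\Omega$, and with their indicators); $\overline{A}$ is negation, $AB$ is conjunction. For events $E,H$ with $H\neq\emptyset$, the conditional event $E|H$ is true if $EH$ is true, false if $\overline{E}H$ is true, void if $\overline{H}$ is true. A conditional random quantity $X|H$ ($X$ with finitely many values, $H\ne\emptyset$) with assessed prevision $\mu=\mathbb{P}(X|H)$ is identified with the random quantity $XH+\mu\overline{H}$; in particular $E|H=EH+x\overline{H}$ with $x=P(E|H)$. Coherence: an assessment of previsions $\mu_j=\mathbb{P}(X_j|K_j)$ on a family of conditional random quantities is coherent if, for every finite subfamily $\{X_1|K_1,\ldots,X_r|K_r\}$ and all real $s_1,\ldots,s_r$, the gain $G=\sum_j s_jK_j(X_j-\mu_j)$ restricted to $K_1\vee\cdots\vee K_r$ satisfies $\min G\leq 0\leq\max G$. Disjunction. For each nonempty $S\subseteq\{1,\ldots,n\}$ let $y_S$ be the assessed prevision of $\mathcal{D}_S=\bigvee_{i\in S}(E_i|H_i)$ ($y_{\{i\}}=x_i=P(E_i|H_i)$, $y_{\{1,\ldots,n\}}=\eta_n$). $\mathcal{D}_S$ is the random quantity, conditional on $\bigvee_{i\in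 S}H_i$, with value $1$ if at least one $E_i|H_i$, $i\in S$, is true; $0$ if all are false; $y_V$ if none is true and the set $V\subseteq S$ of indices of void ones is nonempty (so its value is its prevision $y_S$ when all $H_i$, $i\in S$, are false). Convention: the numbers $y_S$ always form a coherent assessment on the family of all $\mathcal{D}_S$; the assertion holds for every such coherent assessment. *)

(* Defs.v *)
From HB Require Import structures.
From mathcomp Require Import all_boot all_order all_algebra.
From mathcomp Require Import all_classical all_reals all_analysis.

Set Implicit Arguments.
Unset Strict Implicit.
Unset Printing Implicit Defensive.

Import Order.TTheory GRing.Theory Num.Theory.

Local Open Scope classical_set_scope.
Local Open Scope ring_scope.

(* Events are subsets of the sure event [Omega], which need not be finite.   *)

Record cond_event (Omega : Type) := CondEvent {
  consequent : set Omega ;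
  antecedent : set Omega ;
  antecedent_neq0 : antecedent !=set0 }.

Definition ce_true (Omega : Type) (C : cond_event Omega) : set Omega :=
  consequent C `&` antecedent C.

Definition ce_false (Omega : Type) (C : cond_event Omega) : set Omega :=
  ~` consequent C `&` antecedent C.

Definition ce_void (Omega : Type) (C : cond_event Omega) : set Omega :=
  ~` antecedent C.

Record cond_quantity (R : realType) (Omega : Type) := CondQuantity {
  cq_value : Omega -> R ;
  cq_cond : set Omega ;
  cq_finite : finite_set (range cq_value) ;
  cq_cond_neq0 : cq_cond !=set0 }.

Definition is_minimum (R : realType) (A : set R) (m : R) : Prop :=
  A m /\ lbound A m.

Definition is_maximum (R : realType) (A : set R) (m : R) : Prop :=
  A m /\ ubound A m.

Definition gain (R : realType) (Omega : Type) (I : eqType)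
    (X : I -> cond_quantity R Omega) (mu : I -> R)
    (J : seq I) (s : I -> R) (w : Omega) : R :=
  \sum_(j <- J) s j * \1_(cq_cond (X j)) w * (cq_value (X j) w - mu j).

(* Since the quantities take finitely many values, the minimum and maximum   *)
(* of the restricted gain always exist and are unique, so requiring their    *)
(* existence below is not an additional constraint.                          *)
Definition coherent (R : realType) (Omega : Type) (I : eqType)
    (X : I -> cond_quantity R Omega) (mu : I -> R) : Prop :=
  forall (J : seq I) (s : I -> R), uniq J -> J != [::] ->
    let values := gain X mu J s @` \bigcup_(j in [set` J]) cq_cond (X j) in
    (exists2 m : R, is_minimum values m & m <= 0) /\
    (exists2 M : R, is_maximum values M & 0 <= M).

Section Disjunction.
Variables (R : realType) (Omega : Type) (n : nat).
Variables (C : 'I_n -> cond_event Omega) (y : {set 'I_n} -> R).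

Definition void_set (S : {set 'I_n}) (w : Omega) : {set 'I_n} :=
  [set i in S | w \in ce_void (C i)]%SET.

(* The last branch is reached when none is true and some are void; outside  *)
(* [disj_cond S] the void set is [S], so that the value is the prevision     *)
(* [y S], in accordance with the identification of X|H with X H + mu ~H.     *)
Definition disj_value (S : {set 'I_n}) (w : Omega) : R :=
  if [exists i in S, w \in ce_true (C i)] then 1
  else if [forall i in S, w \in ce_false (C i)] then 0
  else y (void_set S w).

Definition disj_cond (S : {set 'I_n}) : set Omega :=
  \bigcup_(i in [set` S]) antecedent (C i).

Lemma disj_value_finite (S : {set 'I_n}) : finite_set (range (disj_value S)).
Proof.
apply: (@sub_finite_set _ _ ([set 1; 0] `|` y @` [set: {set 'I_n}])).
  move=> _ [w _ <-]; rewrite /disj_value.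
  by case: ifP => _; [left; left|case: ifP => _; [left; right|right; exists (void_set S w)]].
by rewrite finite_setU; split; [exact: finite_set2|exact/finite_image/finite_finset].
Qed.

Lemma disj_cond_neq0 (S : {set 'I_n}) : S != finset.set0 -> disj_cond S !=set0.
Proof.
move=> /set0Pn[i iS]; have [w Hw] := antecedent_neq0 (C i).
by exists w, i.
Qed.

Definition disjunction (S : {S : {set 'I_n} | S != finset.set0}) :
    cond_quantity R Omega :=
  CondQuantity (disj_value_finite (val S)) (disj_cond_neq0 (valP S)).

(* [y S] is the prevision of the disjunction over [S]; [y] at the empty set   *)
(* plays no role.                                                             *)
Definition coherent_disjunctions : Prop :=
  coherent disjunction (fun S => y (val S)).

End Disjunction.

(* Main.v *)
Require Import Defs.
From HB Require Import structures.
From mathcomp Require Import all_boot all_order all_algebra.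
From mathcomp Require Import all_classical all_reals all_analysis.
From mathcomp Require Import lra.

Import Order.TTheory GRing.Theory Num.Theory.
Local Open Scope classical_set_scope.
Local Open Scope ring_scope.

(** Give the empty disjunction the prevision 0, and call the result [prev];
    the disjunction over [S] is then worth 1 where some member is true, and
    [prev V] elsewhere, [V] being the set of void members of [S].  The point is
    that every linear inequality valid for these payoffs passes to the
    previsions ([prev_ge]): otherwise one could bet on the combination and win
    for sure.  It is enough that the inequality hold where some member of the
    largest set [T] involved is not void.  There the void members form a proper
    subset of [T], so that the payoff is either 1 or the prevision of a
    disjunction with fewer members.  An inequality between previsions can thus
    be proved by strong induction on [#|T|], the induction hypothesis giving
    the corresponding inequality between payoffs.

    In this way [prev] takes its values in [0, 1] ([prev_bounds]), is monotone
    ([prev_mono]) and is subadditive ([prev_setU]).  Monotonicity bounds every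
    [x i] by [eta]; subadditivity, applied to the full set as the union of its
    singletons, bounds [eta] by the sum of the [x i]. *)

Section Previsions.
Set Implicit Arguments.
Unset Strict Implicit.

Variables (R : realType) (Omega : Type) (n : nat).
Variables (C : 'I_n -> cond_event Omega) (y : {set 'I_n} -> R).

Implicit Types (S T U : {set 'I_n}) (w : Omega).

Definition prev S : R := if S == finset.set0 then 0 else y S.

Definition payoff S w : R :=
  if [exists i in S, w \in ce_true (C i)] then 1 else prev (void_set C S w).

Lemma prev0 : prev finset.set0 = 0.
Proof. by rewrite /prev eqxx. Qed.

Lemma prevE S : S != finset.set0 -> prev S = y S.
Proof. by rewrite /prev => /negbTE ->. Qed.

Lemma in_void_set S w i :
  (i \in void_set C S w) = (i \in S) && (w \in ce_void (C i)).
Proof. by rewrite /void_set inE. Qed.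

Lemma void_set_sub S w : void_set C S w \subset S.
Proof. by apply/fintype.subsetP => i; rewrite in_void_set => /andP[]. Qed.

Lemma void_setS S T w : S \subset T -> void_set C S w \subset void_set C T w.
Proof.
move=> /fintype.subsetP ST; apply/fintype.subsetP => i; rewrite !in_void_set.
by move=> /andP[/ST -> ->].
Qed.

Lemma void_setU S U w :
  void_set C (S :|: U)%SET w = (void_set C S w :|: void_set C U w)%SET.
Proof.
apply/finset.setP => i.
by rewrite finset.in_setU !in_void_set finset.in_setU andb_orl.
Qed.

(** What lets the inductions on cardinality proceed: on the conditioning event,
    a payoff never refers to the prevision that is being assessed. *)
Lemma void_set_proper T w : disj_cond C T w -> void_set C T w \proper T.
Proof.
move=> [i /= iT Hi]; apply/fintype.properP; split; first exact: void_set_sub.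
exists i => //; rewrite in_void_set iT /=.
by apply/negP; rewrite inE /ce_void /setC /=; apply.
Qed.

Lemma payoff0 w : payoff finset.set0 w = 0.
Proof.
rewrite /payoff; case: existsP => [[i]|_]; first by rewrite inE.
suff -> : void_set C finset.set0 w = finset.set0 by exact: prev0.
by apply/eqP; rewrite -finset.subset0 void_set_sub.
Qed.

(** When no member is true, all are false exactly when none is void, and the
    value 0 is then the prevision of the empty disjunction. *)
Lemma disj_valueE S w : disj_value C y S w = payoff S w.
Proof.
rewrite /disj_value /payoff; case: ifPn => // noT.
case: ifPn => [/forallP allF|someV].
  rewrite /prev ifT//; apply/eqP/finset.setP => i; rewrite in_void_set inE.
  apply/negP => /andP[iS]; move: (allF i); rewrite iS /= !inE.
  by move=> -[_ Hi] nHi; apply: nHi.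
rewrite prevE//; move: someV => /forallPn[i]; rewrite negb_imply => /andP[iS niF].
apply/set0Pn; exists i; rewrite in_void_set iS /= inE => Hi.
have [Ei|nEi] := pselect (consequent (C i) w).
  by move/negP: noT; apply; apply/existsP; exists i; rewrite iS inE.
by move/negP: niF; apply; rewrite inE.
Qed.

(** Outside its conditioning event a disjunction is worth its prevision, so the
    indicator in the gain makes no difference. *)
Lemma bet_gain S w : S != finset.set0 ->
  \1_(disj_cond C S) w * (disj_value C y S w - y S) = payoff S w - prev S.
Proof.
move=> S0; rewrite disj_valueE -(prevE S0) indicE.
case: (boolP (w \in disj_cond C S)) => [_|]; first by rewrite mul1r.
rewrite notin_setE => noH; rewrite mul0r.
have vS i : i \in S -> ~ antecedent (C i) w by move=> iS Hi; apply: noH; exists i.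
rewrite /payoff ifN; last first.
  by apply/existsPn => i; apply/negP => /andP[/vS nHi]; rewrite inE => -[].
suff -> : void_set C S w = S by rewrite subrr.
apply/finset.setP => i; rewrite in_void_set; case: (boolP (i \in S)) => //= iS.
by apply/idP; rewrite inE; exact: vS.
Qed.

Hypothesis y_coherent : coherent_disjunctions C y.

(** Were it to fail, betting [p.1] on each [p.2] in [L] would give a gain
    that is everywhere positive on [disj_cond C T].  As coherence speaks of
    families without repetition, the bets are spread over the family of all
    nonempty subsets of [T], whose conditioning events have union
    [disj_cond C T]. *)
Lemma prev_ge T (L : seq (R * {set 'I_n})) (c : R) :
  T != finset.set0 -> (forall p, p \in L -> p.2 \subset T) ->
  (forall w, disj_cond C T w -> c <= \sum_(p <- L) p.1 * payoff p.2 w) ->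
  c <= \sum_(p <- L) p.1 * prev p.2.
Proof.
move=> T0 LT Lc.
pose I := {S : {set 'I_n} | S != finset.set0}.
pose J := [seq S : I <- enum {: I} | val S \subset T].
pose s (S : I) : R := \sum_(p <- L) p.1 * (p.2 == val S)%:R.
have memJ (S : I) : (S \in J) = (val S \subset T).
  by rewrite mem_filter mem_enum andbT.
have uJ : uniq J by rewrite filter_uniq// enum_uniq.
have J0 : J != [::].
  apply/eqP => J0; have := memJ (exist _ T T0).
  by rewrite J0 in_nil /= fintype.subxx.
have [[m [[w [S /= SJ Sw]] <- _] m0] _] := @y_coherent J s uJ J0.
have Tw : disj_cond C T w.
  case: Sw => i /= iS Hi; exists i => //=.
  by move: SJ; rewrite memJ => /fintype.subsetP; apply.
suff gE : gain (disjunction C y) (fun S : I => y (val S)) J s w =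
    \sum_(p <- L) p.1 * payoff p.2 w - \sum_(p <- L) p.1 * prev p.2.
  by move: m0; rewrite gE subr_le0; exact/le_trans/Lc.
rewrite /gain -sumrB.
under eq_bigr => S' _.
  rewrite -mulrA (bet_gain w (valP S')) /s mulr_suml.
  over.
rewrite exchange_big /=; apply: eq_big_seq => p pL; rewrite -mulrBr.
under eq_bigr do rewrite -mulrA.
rewrite -mulr_sumr; congr (_ * _).
have [p0|p0] := eqVneq p.2 finset.set0.
  rewrite p0 payoff0 prev0 subrr big1// => S' _.
  by rewrite eq_sym (negbTE (valP S')) mul0r.
have pJ : exist _ p.2 p0 \in J by rewrite memJ /= LT.
rewrite (bigD1_seq _ pJ uJ) /= eqxx mul1r big1 ?addr0// => S' /eqP neS.
case: eqP => [eS|]; last by rewrite mul0r.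
by exfalso; apply: neS; apply: val_inj; rewrite /= eS.
Qed.

Lemma prev_bounds S : 0 <= prev S <= 1.
Proof.
have [k] := ubnP #|S|; elim: k S => // k IH S; rewrite ltnS => Sk.
have [->|S0] := eqVneq S finset.set0; first by rewrite prev0; lra.
have pay w : disj_cond C S w -> 0 <= payoff S w <= 1.
  move=> Sw; rewrite /payoff; case: ifP => _; first by lra.
  by apply: IH; apply: leq_trans Sk; exact/proper_card/void_set_proper.
apply/andP; split.
  have := @prev_ge S [:: (1, S)] 0 S0; rewrite big_seq1 mul1r; apply.
    by move=> p; rewrite inE => /eqP ->.
  by move=> w /pay; rewrite big_seq1 mul1r => /andP[].
have := @prev_ge S [:: (-1, S)] (-1) S0; rewrite big_seq1 mulN1r lerN2; apply.
  by move=> p; rewrite inE => /eqP ->.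
by move=> w /pay; rewrite big_seq1 mulN1r lerN2 => /andP[].
Qed.

Lemma payoff_bounds S w : 0 <= payoff S w <= 1.
Proof. by rewrite /payoff; case: ifP => _; [lra|exact: prev_bounds]. Qed.

(** A true member of [S] is one of [T], and a void one too; so the payoffs
    compare as 1 and 1, as something at most 1 and 1, or as the previsions of
    nested sets of void members, the larger of them proper in [T]. *)
Lemma prev_mono S T : S \subset T -> prev S <= prev T.
Proof.
have [k] := ubnP #|T|; elim: k S T => // k IH S T; rewrite ltnS => Tk ST.
have [T0|T0] := eqVneq T finset.set0.
  by move: ST; rewrite T0 finset.subset0 => /eqP ->.
have := @prev_ge T [:: (1, T); (-1, S)] 0 T0.
rewrite !big_cons big_nil /= => H; rewrite -subr_ge0.
suff : 0 <= 1 * prev T + (-1 * prev S + 0) by lra.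
apply: H => [p|w Tw].
  by rewrite !inE => /orP[/eqP ->|/eqP ->].
rewrite !big_cons big_nil /=.
suff : payoff S w <= payoff T w by lra.
have /andP[_ S1] := payoff_bounds S w.
rewrite {2}/payoff; case: ifPn => // noT.
rewrite /payoff ifN; last first.
  apply: contra noT => /existsP[i /andP[iS Ti]]; apply/existsP; exists i.
  by rewrite (fintype.subsetP ST).
apply: IH; last exact: void_setS.
by apply: leq_trans Tk; exact/proper_card/void_set_proper.
Qed.

(** A true member of the union is one of [S] or of [U], and the other payoff is
    nonnegative; failing any, the three payoffs are previsions of sets of void
    members, which again satisfy the union relation. *)
Lemma prev_setU S U : prev (S :|: U)%SET <= prev S + prev U.
Proof.
have [k] := ubnP #|(S :|: U)%SET|; elim: k S U => // k IH S U; rewrite ltnS => Tk.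
have [T0|T0] := eqVneq (S :|: U)%SET finset.set0.
  have /andP[S0 _] := prev_bounds S; have /andP[U0 _] := prev_bounds U.
  by rewrite T0 prev0; lra.
have := @prev_ge (S :|: U)%SET [:: (1, S); (1, U); (-1, (S :|: U)%SET)] 0 T0.
rewrite !big_cons big_nil /= => H.
suff : 0 <= 1 * prev S + (1 * prev U + (-1 * prev (S :|: U)%SET + 0)) by lra.
apply: H => [p|w Tw].
  rewrite !inE => /or3P[/eqP ->|/eqP ->|/eqP ->] //=.
    exact: finset.subsetUl.
  exact: finset.subsetUr.
rewrite !big_cons big_nil /=.
suff : payoff (S :|: U)%SET w <= payoff S w + payoff U w by lra.
have /andP[S0 _] := payoff_bounds S w; have /andP[U0 _] := payoff_bounds U w.
have /andP[_ SU1] := payoff_bounds (S :|: U)%SET w.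
have pay1 (A : {set 'I_n}) i : i \in A -> w \in ce_true (C i) -> payoff A w = 1.
  by move=> iA Ti; rewrite /payoff ifT//; apply/existsP; exists i; rewrite iA.
rewrite {1}/payoff; case: ifPn => [/existsP[i /andP[]]|noT].
  by rewrite finset.in_setU => /orP[] /pay1/[apply]; lra.
have noTsub (A : {set 'I_n}) : A \subset (S :|: U)%SET ->
    payoff A w = prev (void_set C A w).
  move=> sA; rewrite /payoff ifN//; apply: contra noT => /existsP[i /andP[iA Ti]].
  by apply/existsP; exists i; rewrite (fintype.subsetP sA).
rewrite !noTsub ?finset.subsetUl ?finset.subsetUr// void_setU.
apply: IH; rewrite -void_setU.
by apply: leq_trans Tk; exact/proper_card/void_set_proper.
Qed.

Lemma prev_le_sum S : prev S <= \sum_(i in S) prev [set i]%SET.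
Proof.
have {1}-> : S = (\bigcup_(i in S) [set i])%SET.
  apply/finset.setP => j; apply/idP/finset.bigcupP => [jS|[i iS]].
    by exists j => //; rewrite finset.inE.
  by rewrite finset.inE => /eqP ->.
elim/big_rec2: _ => [|i s A _ le_s]; first by rewrite prev0.
by apply: le_trans (prev_setU _ _) _; rewrite lerD2l.
Qed.

End Previsions.

Theorem theorem14 (R : realType) (Omega : Type) (n : nat)
  (C : 'I_n.+1 -> cond_event Omega)
  (y : {set 'I_n.+1} -> R) (x : 'I_n.+1 -> R) (eta : R)
  (y_coherent : coherent_disjunctions C y)
  (hx : forall i : 'I_n.+1, y [set i]%SET = x i)
  (heta : y [set: 'I_n.+1]%SET = eta) :
  \big[Num.max/x ord0]_(i < n.+1) x i <= eta /\
  eta <= Num.min (\sum_(i < n.+1) x i) 1.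
Proof.
have prev1 i : prev y [set i]%SET = x i.
  by rewrite prevE ?hx//; apply/set0Pn; exists i; rewrite finset.inE.
have prevT : prev y [set: 'I_n.+1]%SET = eta.
  by rewrite prevE//; apply/set0Pn; exists ord0; rewrite finset.in_setT.
have x_le i : x i <= eta.
  by rewrite -prev1 -prevT; apply: (prev_mono y_coherent); exact: finset.subsetT.
split; first by elim/big_ind: _ => // a b; rewrite ge_max => -> ->.
rewrite le_min -prevT; apply/andP; split; last first.
  by have /andP[] := prev_bounds y_coherent [set: 'I_n.+1]%SET.
apply: le_trans (prev_le_sum y_coherent _) _.
by rewrite (eq_bigl xpredT) => [|i]; [rewrite (eq_bigr x)|rewrite finset.in_setT].
Qed.
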